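(* Let $\Gamma$ be a local type environment and $\mathcal{M},\mathcal{M}'$ multiparty sessions. If $\Gamma\vdash\mathcal{M}$ and $\mathcal{M}\xrightarrow{(\mathtt{p},\mathtt{q})\ell}\mathcal{M}'$, then there exists a local type environment $\Gamma'$ such that $\Gamma\xrightarrow{(\mathtt{p},\mathtt{q})\ell}\Gamma'$ and $\Gamma'\vdash\mathcal{M}'$.
   Context: PROCESSES. Processes: $P ::= \mathtt{p}!\ell(e).P \mid \sum_{i\in I}\mathtt{p}?\ell_i(x_i).P_i \mid \mathtt{if}\ e\ \mathtt{then}\ P\ \mathtt{else}\ P \mid \mu X.P \mid X \mid \mathbf{0}$, with $I$ finite nonempty, recursion guarded; expressions $e$ are variables, values (booleans, integers, naturals) or built with operators such as $\mathtt{succ}$, $\mathtt{neg}$, $\neg$ and nondeterministic choice; $e\downarrow v$ is standard evaluation. Sessions: $\mathcal{M} ::= \mathtt{p}\triangleleft P \mid \mathcal{M}\mid\mathcal{M} \mid \mathcal{O}$; $\prod_{i\in I}\mathtt{p}_i\triangleleft P_i$ is parallel composition. Structural congruence $\equiv$ is the least congruence with $\mathcal{M}\mid\mathcal{N}\equiv\mathcal{N}\mid\mathcal{M}$, $(\mathcal{L}\mid\mathcal{M})\mid\mathcal{N}\equiv\mathcal{L}\mid(\mathcal{M}\mid\mathcal{N})$, $\mathcal{M}\mid\mathcal{O}\equiv\mathcal{M}$. Unfolding $\Rrightarrow$ is the least relation with: $\mathcal{M}\equiv\mathcal{N}\Rightarrow\mathcal{M}\Rrightarrow\mathcal{N}$;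 transitivity; $\mathtt{p}\triangleleft\mu X.P\mid\mathcal{N}\Rrightarrow\mathtt{p}\triangleleft P[\mu X.P/X]\mid\mathcal{N}$; $e\downarrow\mathtt{true}\Rightarrow \mathtt{p}\triangleleft\mathtt{if}\ e\ \mathtt{then}\ P\ \mathtt{else}\ Q\mid\mathcal{N}\Rrightarrow\mathtt{p}\triangleleft P\mid\mathcal{N}$; $e\downarrow\mathtt{false}\Rightarrow \mathtt{p}\triangleleft\mathtt{if}\ e\ \mathtt{then}\ P\ \mathtt{else}\ Q\mid\mathcal{N}\Rrightarrow\mathtt{p}\triangleleft Q\mid\mathcal{N}$. Labelled reduction is the least relation with: (R-comm) if $j\in I$ and $e\downarrow v$ then $\mathtt{q}\triangleleft\sum_{i\in I}\mathtt{p}?\ell_i(x_i).P_i\mid\mathtt{p}\triangleleft\mathtt{q}!\ell_j(e).Q\mid\mathcal{N}\xrightarrow{(\mathtt{p},\mathtt{q})\ell_j}\mathtt{q}\triangleleft P_j[v/x_j]\mid\mathtt{p}\triangleleft Q\mid\mathcal{N}$ (the first participant of the label is the sender); (R-unfold) if $\mathcal{M}\Rrightarrow\mathcal{M}'$, $\mathcal{M}'\xrightarrow{\lambda}\mathcal{N}'$ and $\mathcal{N}'\Rrightarrow\mathcal{N}$ then $\mathcal{M}\xrightarrow{\lambda}\mathcal{N}$. TYPES. Sorts $\mathtt{int},\mathtt{bool},\mathtt{nat}$, subsorting $\le$ least reflexive with $\mathtt{nat}\le\mathtt{int}$. Local types coinductively: $T ::= \mathtt{end}\mid\mathtt{p}\&\{\ell_i(S_i).T_i\}_{i\in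 I}\mid\mathtt{p}\oplus\{\ell_i(S_i).T_i\}_{i\in I}$. Subtyping $\le$: largest relation with $\mathtt{end}\le\mathtt{end}$; $\mathtt{p}\&\{\ell_i(S_i).T_i\}_{i\in I\cup J}\le\mathtt{p}\&\{\ell_i(S'_i).T'_i\}_{i\in I}$ if $S'_i\le S_i$, $T_i\le T'_i$ for $i\in I$; $\mathtt{p}\oplus\{\ell_i(S_i).T_i\}_{i\in I}\le\mathtt{p}\oplus\{\ell_i(S'_i).T'_i\}_{i\in I\cup J}$ if $S_i\le S'_i$, $T_i\le T'_i$ for $i\in I$. Global types coinductively: $\mathbb{G}::=\mathtt{end}\mid\mathtt{p}\to\mathtt{q}:\{\ell_i(S_i).\mathbb{G}_i\}_{i\in I}$; $\mathrm{pt}(\mathbb{G})$ least solution of $\mathrm{pt}(\mathtt{end})=\emptyset$, $\mathrm{pt}(\mathtt{p}\to\mathtt{q}:\{\ell_i(S_i).\mathbb{G}_i\})=\{\mathtt{p},\mathtt{q}\}\cup\bigcup_i\mathrm{pt}(\mathbb{G}_i)$. Projection $\mathbb{G}\upharpoonright\mathtt{r}$ is the (functional) largest relation such that: $\mathtt{r}\notin\mathrm{pt}(\mathbb{G})$ gives $\mathtt{end}$; $\mathtt{p}\to\mathtt{r}:\{\ell_i(S_i).\mathbb{G}_i\}$ gives $\mathtt{p}\&\{\ell_i(S_i).T_i\}$ with $\mathbb{G}_i\upharpoonright\mathtt{r}=T_i$; $\mathtt{r}\to\mathtt{q}:\{\ell_i(S_i).\mathbb{G}_i\}$ gives $\mathtt{q}\oplus\{\ell_i(S_i).T_i\}$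 with $\mathbb{G}_i\upharpoonright\mathtt{r}=T_i$; $\mathtt{p}\to\mathtt{q}:\{\ell_i(S_i).\mathbb{G}_i\}$ with $\mathtt{r}\notin\{\mathtt{p},\mathtt{q}\}$ gives $T$ with $\mathbb{G}_i\upharpoonright\mathtt{r}=T$ for all $i$. $\mathbb{G}$ is balanced if for every subtree $\mathbb{G}'$ there is $k$ such that every $\mathtt{p}\in\mathrm{pt}(\mathbb{G}')$ occurs on every path from the root of $\mathbb{G}'$ of length $\ge k$ or ending in $\mathtt{end}$. A local type environment $\Gamma$ is a finite map from participants to local types; $\Gamma_1,\Gamma_2$ is disjoint union. $\Gamma\sqsubseteq\mathbb{G}$ (association) iff for all $\mathtt{p}\in\mathrm{pt}(\mathbb{G})$, $\mathtt{p}\in\mathrm{dom}(\Gamma)$ and $\Gamma(\mathtt{p})\le\mathbb{G}\upharpoonright\mathtt{p}$, and for all $\mathtt{p}\notin\mathrm{pt}(\mathbb{G})$, $\mathtt{p}\notin\mathrm{dom}(\Gamma)$ or $\Gamma(\mathtt{p})=\mathtt{end}$. Environment transitions are the least relation with: $\mathtt{p}:\mathtt{q}\&\{\ell_i(S_i).T_i\}_{i\in I}\xrightarrow{\mathtt{p}:\mathtt{q}\&\ell_k(S_k)}\mathtt{p}:T_k$ and $\mathtt{p}:\mathtt{q}\oplus\{\ell_i(S_i).T_i\}_{i\in I}\xrightarrow{\mathtt{p}:\mathtt{q}\oplus\ell_k(S_k)}\mathtt{p}:T_k$ ($k\in I$); $\Gamma\xrightarrow{\alpha}\Gamma'\Rightarrow\Gamma,\mathtt{p}:T\xrightarrow{\alpha}\Gamma',\mathtt{p}:T$;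 $\Gamma_1\xrightarrow{\mathtt{p}:\mathtt{q}\oplus\ell(S)}\Gamma_1'$, $\Gamma_2\xrightarrow{\mathtt{q}:\mathtt{p}\&\ell(S')}\Gamma_2'$, $S\le S'$ $\Rightarrow$ $\Gamma_1,\Gamma_2\xrightarrow{(\mathtt{p},\mathtt{q})\ell}\Gamma_1',\Gamma_2'$. TYPING. $\Theta\vdash P:T$ is the least relation with (expression typing $\Theta\vdash e:S$ standard): $\Theta\vdash\mathbf{0}:\mathtt{end}$; $\Theta,X:T\vdash X:T$; $\Theta,X:T\vdash P:T\Rightarrow\Theta\vdash\mu X.P:T$; $\Theta\vdash e:\mathtt{bool}$, $\Theta\vdash P_1:T$, $\Theta\vdash P_2:T\Rightarrow\Theta\vdash\mathtt{if}\ e\ \mathtt{then}\ P_1\ \mathtt{else}\ P_2:T$; $\Theta\vdash P:T$, $T\le T'\Rightarrow\Theta\vdash P:T'$; $\forall i\in I.\ \Theta,x_i:S_i\vdash P_i:T_i\Rightarrow\Theta\vdash\sum_{i\in I}\mathtt{p}?\ell_i(x_i).P_i:\mathtt{p}\&\{\ell_i(S_i).T_i\}_{i\in I}$; $\Theta\vdash e:S$, $\Theta\vdash P:T\Rightarrow\Theta\vdash\mathtt{p}!\ell(e).P:\mathtt{p}\oplus\{\ell(S).T\}$. Session typing: $\Gamma\vdash\prod_{i\in I}\mathtt{p}_i\triangleleft P_i$ iff for all $i\in I$, $\emptyset\vdash P_i:\Gamma(\mathtt{p}_i)$, and $\Gamma\sqsubseteq\mathbb{G}$ for some balanced, well-formed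 global type $\mathbb{G}$ projectable onto every participant.
   Formalization: Γ ⊢ M also requires the participants of M to be pairwise distinct (two copies of a sender p refute the claim otherwise); labels within a choice are distinct; projection past a node not involving r requires r ∈ pt(G), so that it is functional; well-formed means sender ≠ receiver. *)

(* Defs.v *)
From HB Require Import structures.
From mathcomp Require Import all_boot all_order ssralg ssrint finmap.

Set Implicit Arguments.
Unset Strict Implicit.
Unset Printing Implicit Defensive.

Local Open Scope fset_scope.
Local Open Scope fmap_scope.

Definition participant : Type := nat.
Definition label : Type := nat.

(* The index set I of a family {l_i ...}_{i in I} is taken to be the set of its
   labels itself; this builds in that labels are pairwise distinct and that I
   is finite and nonempty. The elements of I : labelset are used as indices,
   and fsval i is the label of index i. *)
Record labelset : Type := Labelset {
  labels :> {fset label};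
  labels_neq0 : labels != fset0 }.

HB.instance Definition _ := [isSub for labels].
HB.instance Definition _ := [Choice of labelset by <:].

Lemma fset1_neq0 (l : label) : [fset l] != fset0.
Proof. by apply/fset0Pn; exists l; rewrite inE. Qed.

Definition labelset1 (l : label) : labelset := Labelset (fset1_neq0 l).

Inductive value : Type :=
| vbool of bool
| vint of int
| vnat of nat.

(* Expression and process variables are de Bruijn indices, in two separate
   namespaces. *)
Inductive expr : Type :=
| evar of nat
| eval of value
| esucc of expr
| eneg of expr
| enot of expr
| echoice of expr & expr.

Inductive evals : expr -> value -> Prop :=
| evals_val v : evals (eval v) v
| evals_succ e n : evals e (vnat n) -> evals (esucc e) (vnat n.+1)
| evals_neg e z : evals e (vint z) -> evals (eneg e) (vint (- z)%R)
| evals_neg_nat e n : evals e (vnat n) -> evals (eneg e) (vint (- n%:Z)%R)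
| evals_not e b : evals e (vbool b) -> evals (enot e) (vbool (~~ b))
| evals_choicel e1 e2 v : evals e1 v -> evals (echoice e1 e2) v
| evals_choicer e1 e2 v : evals e2 v -> evals (echoice e1 e2) v.

(* Each branch of precv binds expression variable 0; pmu binds process
   variable 0. *)
Inductive proc : Type :=
| psend of participant & label & expr & proc
| precv (p : participant) (I : labelset) of (I -> proc)
| pif of expr & proc & proc
| pmu of proc
| pvar of nat
| pnil.

Definition scons (A : Type) (a : A) (s : nat -> A) (n : nat) : A :=
  if n is m.+1 then s m else a.

Definition upren (r : nat -> nat) : nat -> nat := scons 0 (succn \o r).

Fixpoint esubst (s : nat -> expr) (e : expr) : expr :=
  match e with
  | evar n => s n
  | eval v => eval v
  | esucc e => esucc (esubst s e)
  | eneg e => eneg (esubst s e)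
  | enot e => enot (esubst s e)
  | echoice e1 e2 => echoice (esubst s e1) (esubst s e2)
  end.

Definition eren (r : nat -> nat) : expr -> expr := esubst (evar \o r).

Definition eup (s : nat -> expr) : nat -> expr :=
  scons (evar 0) (eren succn \o s).

(* Simultaneous substitution of expressions for the expression variables. *)
Fixpoint pesubst (s : nat -> expr) (P : proc) : proc :=
  match P with
  | psend p l e P => psend p l (esubst s e) (pesubst s P)
  | @precv p J P => precv p (fun j : J => pesubst (eup s) (P j))
  | pif e P Q => pif (esubst s e) (pesubst s P) (pesubst s Q)
  | pmu P => pmu (pesubst s P)
  | pvar n => pvar n
  | pnil => pnil
  end.

(* Renaming of expression variables along r and of process variables along x. *)
Fixpoint pren (r x : nat -> nat) (P : proc) : proc :=
  match P with
  | psend p l e P => psend p l (eren r e) (pren r x P)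
  | @precv p J P => precv p (fun j : J => pren (upren r) x (P j))
  | pif e P Q => pif (eren r e) (pren r x P) (pren r x Q)
  | pmu P => pmu (pren r (upren x) P)
  | pvar n => pvar (x n)
  | pnil => pnil
  end.

(* Simultaneous substitution of processes for the process variables. *)
Fixpoint psubst (t : nat -> proc) (P : proc) : proc :=
  match P with
  | psend p l e P => psend p l e (psubst t P)
  | @precv p J P => precv p (fun j : J => psubst (pren succn id \o t) (P j))
  | pif e P Q => pif e (psubst t P) (psubst t Q)
  | pmu P => pmu (psubst (scons (pvar 0) (pren id succn \o t)) P)
  | pvar n => t n
  | pnil => pnil
  end.

(* P[v/x] and P[Q/X], where x, resp. X, is variable 0 of P. *)
Definition vsubst1 (v : value) (P : proc) : proc :=
  pesubst (scons (eval v) evar) P.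

Definition psubst1 (Q P : proc) : proc := psubst (scons Q pvar) P.

(* Process variable n occurs free in P outside every communication prefix. *)
Fixpoint exposed (n : nat) (P : proc) : bool :=
  match P with
  | pif _ P Q => exposed n P || exposed n Q
  | pmu P => exposed n.+1 P
  | pvar m => m == n
  | psend _ _ _ _ | precv _ _ _ | pnil => false
  end.

Fixpoint guarded (P : proc) : Prop :=
  match P with
  | psend _ _ _ P => guarded P
  | @precv _ J P => forall j : J, guarded (P j)
  | pif _ P Q => guarded P /\ guarded Q
  | pmu P => ~~ exposed 0 P /\ guarded P
  | pvar _ | pnil => True
  end.

Inductive session : Type :=
| sproc of participant & proc
| spar of session & session
| snil.

Fixpoint participants (M : session) : seq participant :=
  match M with
  | sproc p _ => [:: p]
  | spar M N => participants M ++ participants N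
  | snil => [::]
  end.

(* "for all i in I, F p_i P_i", when M is the product over i in I of the
   p_i <| P_i. *)
Fixpoint forall_components (F : participant -> proc -> Prop) (M : session) :
    Prop :=
  match M with
  | sproc p P => F p P
  | spar M N => forall_components F M /\ forall_components F N
  | snil => True
  end.

Inductive scong : session -> session -> Prop :=
| scong_refl M : scong M M
| scong_sym M N : scong M N -> scong N M
| scong_trans L M N : scong L M -> scong M N -> scong L N
| scong_par M M' N N' :
    scong M M' -> scong N N' -> scong (spar M N) (spar M' N')
| scong_comm M N : scong (spar M N) (spar N M)
| scong_assoc L M N : scong (spar (spar L M) N) (spar L (spar M N))
| scong_nil M : scong (spar M snil) M.

Inductive sunfold : session -> session -> Prop :=
| sunfold_cong M N : scong M N -> sunfold M N
| sunfold_trans L M N : sunfold L M -> sunfold M N -> sunfold L N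
| sunfold_mu p P N :
    sunfold (spar (sproc p (pmu P)) N)
            (spar (sproc p (psubst1 (pmu P) P)) N)
| sunfold_true p e P Q N : evals e (vbool true) ->
    sunfold (spar (sproc p (pif e P Q)) N) (spar (sproc p P) N)
| sunfold_false p e P Q N : evals e (vbool false) ->
    sunfold (spar (sproc p (pif e P Q)) N) (spar (sproc p Q) N).

(* sstep M p q l M' : p is the sender and q the receiver. *)
Inductive sstep :
  session -> participant -> participant -> label -> session -> Prop :=
| sstep_comm p q (I : labelset) (P : I -> proc) (j : I) e v Q N :
    evals e v ->
    sstep (spar (spar (sproc q (precv p P))
                      (sproc p (psend q (fsval j) e Q))) N)
          p q (fsval j)
          (spar (spar (sproc q (vsubst1 v (P j))) (sproc p Q)) N)
| sstep_unfold M M' N' N p q l :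
    sunfold M M' -> sstep M' p q l N' -> sunfold N' N -> sstep M p q l N.

Inductive vsort : Type := sint | sbool | snat.

Inductive subsort : vsort -> vsort -> Prop :=
| subsort_refl S : subsort S S
| subsort_nat_int : subsort snat sint.

CoInductive ltype : Type :=
| lend
| lrecv (p : participant) (I : labelset) of (I -> vsort) & (I -> ltype)
| lsend (p : participant) (I : labelset) of (I -> vsort) & (I -> ltype).

CoInductive subtype : ltype -> ltype -> Prop :=
| subtype_end : subtype lend lend
| subtype_recv p (I J : labelset) S T S' T' :
    J `<=` I ->
    (forall (i : I) (j : J), fsval i = fsval j -> subsort (S' j) (S i)) ->
    (forall (i : I) (j : J), fsval i = fsval j -> subtype (T i) (T' j)) ->
    subtype (@lrecv p I S T) (@lrecv p J S' T')
| subtype_send p (I J : labelset) S T S' T' :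
    I `<=` J ->
    (forall (i : I) (j : J), fsval i = fsval j -> subsort (S i) (S' j)) ->
    (forall (i : I) (j : J), fsval i = fsval j -> subtype (T i) (T' j)) ->
    subtype (@lsend p I S T) (@lsend p J S' T').

CoInductive gtype : Type :=
| gend
| gmsg (p q : participant) (I : labelset) of (I -> vsort) & (I -> gtype).

Inductive gpart (r : participant) : gtype -> Prop :=
| gpart_sender q (I : labelset) S G : gpart r (@gmsg r q I S G)
| gpart_receiver p (I : labelset) S G : gpart r (@gmsg p r I S G)
| gpart_cont p q (I : labelset) S G (i : I) :
    gpart r (G i) -> gpart r (@gmsg p q I S G).

(* The premise that r is a participant in proj_other is what makes the largest
   relation functional: without it, an infinite global type in which r does not
   occur would project onto every local type. *)
CoInductive proj : gtype -> participant -> ltype -> Prop :=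
| proj_end G r : ~ gpart r G -> proj G r lend
| proj_recv p r (I : labelset) S G T :
    (forall i : I, proj (G i) r (T i)) ->
    proj (@gmsg p r I S G) r (@lrecv p I S T)
| proj_send r q (I : labelset) S G T :
    (forall i : I, proj (G i) r (T i)) ->
    proj (@gmsg r q I S G) r (@lsend q I S T)
| proj_other p q r (I : labelset) S G T :
    r != p -> r != q -> gpart r (@gmsg p q I S G) ->
    (forall i : I, proj (G i) r T) ->
    proj (@gmsg p q I S G) r T.

(* gpath G w G' : w lists the (sender, receiver) pairs of the nodes traversed
   by a path from the root of G to its subtree G', the root of G' excluded. *)
Inductive gpath : gtype -> seq (participant * participant) -> gtype -> Prop :=
| gpath_nil G : gpath G [::] G
| gpath_cons p q (I : labelset) S G (i : I) w G' :
    gpath (G i) w G' -> gpath (@gmsg p q I S G) ((p, q) :: w) G'.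

Definition occurs (r : participant) (w : seq (participant * participant)) :=
  has (fun pq => (r == pq.1) || (r == pq.2)) w.

Definition balanced (G : gtype) : Prop :=
  forall w0 G', gpath G w0 G' ->
  exists k : nat, forall r, gpart r G' ->
  forall w G'', gpath G' w G'' -> k <= size w \/ G'' = gend -> occurs r w.

CoInductive gwf : gtype -> Prop :=
| gwf_end : gwf gend
| gwf_msg p q (I : labelset) S G :
    p != q -> (forall i : I, gwf (G i)) -> gwf (@gmsg p q I S G).

Definition projectable (G : gtype) : Prop := forall r, exists T, proj G r T.

Definition env : Type := {fmap participant -> ltype}.

Inductive action : Type :=
| arecv (p q : participant) (l : label) (S : vsort)
| asend (p q : participant) (l : label) (S : vsort)
| acomm (p q : participant) (l : label).

Inductive env_step : env -> action -> env -> Prop :=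
| env_step_recv p q (I : labelset) S T (k : I) :
    env_step [fmap].[p <- @lrecv q I S T] (arecv p q (fsval k) (S k))
             [fmap].[p <- T k]
| env_step_send p q (I : labelset) S T (k : I) :
    env_step [fmap].[p <- @lsend q I S T] (asend p q (fsval k) (S k))
             [fmap].[p <- T k]
| env_step_frame (Gam Gam' : env) a p T :
    p \notin domf Gam -> p \notin domf Gam' ->
    env_step Gam a Gam' -> env_step Gam.[p <- T] a Gam'.[p <- T]
| env_step_comm (Gam1 Gam1' Gam2 Gam2' : env) p q l S S' :
    [disjoint domf Gam1 & domf Gam2] -> [disjoint domf Gam1' & domf Gam2'] ->
    env_step Gam1 (asend p q l S) Gam1' ->
    env_step Gam2 (arecv q p l S') Gam2' ->
    subsort S S' ->
    env_step (Gam1 + Gam2) (acomm p q l) (Gam1' + Gam2').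

Definition assoc (Gam : env) (G : gtype) : Prop :=
  (forall p, gpart p G ->
     exists T T', [/\ Gam.[? p] = Some T, proj G p T' & subtype T T']) /\
  (forall p, ~ gpart p G -> Gam.[? p] = None \/ Gam.[? p] = Some lend).

Inductive typ_value : value -> vsort -> Prop :=
| typ_vbool b : typ_value (vbool b) sbool
| typ_vint z : typ_value (vint z) sint
| typ_vnat n : typ_value (vnat n) snat.

Inductive typ_expr (The : seq vsort) : expr -> vsort -> Prop :=
| typ_evar n S : onth The n = Some S -> typ_expr The (evar n) S
| typ_eval v S : typ_value v S -> typ_expr The (eval v) S
| typ_esucc e : typ_expr The e snat -> typ_expr The (esucc e) snat
| typ_eneg e : typ_expr The e sint -> typ_expr The (eneg e) sint
| typ_enot e : typ_expr The e sbool -> typ_expr The (enot e) sbool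
| typ_echoice e1 e2 S :
    typ_expr The e1 S -> typ_expr The e2 S -> typ_expr The (echoice e1 e2) S
| typ_esub e S S' : typ_expr The e S -> subsort S S' -> typ_expr The e S'.

(* The context Theta is split into its part The on expression variables and its
   part Thp on process variables. *)
Inductive typ_proc : seq vsort -> seq ltype -> proc -> ltype -> Prop :=
| typ_pnil The Thp : typ_proc The Thp pnil lend
| typ_pvar The Thp n T : onth Thp n = Some T -> typ_proc The Thp (pvar n) T
| typ_pmu The Thp P T :
    typ_proc The (T :: Thp) P T -> typ_proc The Thp (pmu P) T
| typ_pif The Thp e P1 P2 T :
    typ_expr The e sbool -> typ_proc The Thp P1 T -> typ_proc The Thp P2 T ->
    typ_proc The Thp (pif e P1 P2) T
| typ_psub The Thp P T T' :
    typ_proc The Thp P T -> subtype T T' -> typ_proc The Thp P T'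
| typ_precv The Thp p (I : labelset) (P : I -> proc) S T :
    (forall i : I, typ_proc (S i :: The) Thp (P i) (T i)) ->
    typ_proc The Thp (precv p P) (@lrecv p I S T)
| typ_psend The Thp p l e P S T :
    typ_expr The e S -> typ_proc The Thp P T ->
    typ_proc The Thp (psend p l e P)
      (@lsend p (labelset1 l) (fun=> S) (fun=> T)).

(* The conventions on the syntax of sessions: the participants of a parallel
   composition are pairwise distinct and recursion is guarded. *)
Definition wf_session (M : session) : Prop :=
  uniq (participants M) /\ forall_components (fun _ P => guarded P) M.

Definition typ_session (Gam : env) (M : session) : Prop :=
  [/\ wf_session M,
      forall_components (fun p P =>
        exists2 T, Gam.[? p] = Some T & typ_proc [::] [::] P T) M
    & exists G, [/\ balanced G, gwf G, projectable G & assoc Gam G]].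

(* Main.v *)
From mathcomp Require Import all_boot finmap.
From Stdlib Require Import Eqdep_dec.
Require Import Defs.

Set Implicit Arguments.
Unset Strict Implicit.
Unset Printing Implicit Defensive.

Local Open Scope fset_scope.
Local Open Scope fmap_scope.

(* Unfolding preserves typing, so the point is a single communication from p to
   q. Inverting the typing of the two processes and the association with the
   global type G, the projections of G onto p and q start with an output to q and
   an input from p. By balancedness every branch of G reaches, after finitely
   many nodes not involving p or q, a message from p to q, and contracting all
   these messages along the label l gives a global type G' (relation gstep).
   Projection commutes with this contraction, and G' is again balanced because a
   non-terminated projection is the same in all the branches skipped. *)

(** Inverting facts about families indexed by a label set leaves equalities of dependent pairs.
    Label sets have decidable equality, so these can be split without an axiom; [inv] automates
    this. *)
Lemma labelset_existT_inj (F : labelset -> Type) (I : labelset) (x y : F I) :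
  existT F I x = existT F I y -> x = y.
Proof.
by apply: inj_pair2_eq_dec => J K; case: (eqVneq J K) => [|/eqP]; [left|right].
Qed.

Ltac inv H :=
  inversion H; subst;
  repeat match goal with
  | E : existT _ _ _ = existT _ _ _ |- _ => apply labelset_existT_inj in E
  end; subst; clear H.

Lemma labelset_inhabited (I : labelset) : exists i : I, True.
Proof. by case: I => A A0; case/fset0Pn: (A0) => x xA; exists [` xA]. Qed.

(** * Guardedness *)

Lemma exposed_pesubst s n P : exposed n (pesubst s P) = exposed n P.
Proof. by elim: P s n => //= e P IHP Q IHQ s n; rewrite IHP IHQ. Qed.

Lemma guarded_pesubst s P : guarded P -> guarded (pesubst s P).
Proof.
elim: P s => //= [p I P IHP|e P IHP Q IHQ|P IHP] s.
- by move=> gP i; apply: IHP.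
- by case=> gP gQ; split; [apply: IHP | apply: IHQ].
- by rewrite exposed_pesubst => -[-> gP]; split=> //; apply: IHP.
Qed.

Lemma exposed_pren r x n P :
  exposed n (pren r x P) -> exists2 m, exposed m P & x m = n.
Proof.
elim: P r x n => //= [e P IHP Q IHQ|P IHP|m] r x n.
- case/orP=> [/IHP|/IHQ] [m mP <-]; exists m => //; rewrite mP ?orbT //.
- by case/IHP=> -[|m] mP //= [<-]; exists m.
- by move/eqP <-; exists m => /=.
Qed.

Lemma guarded_pren r x P : guarded P -> guarded (pren r x P).
Proof.
elim: P r x => //= [p I P IHP|e P IHP Q IHQ|P IHP] r x.
- by move=> gP i; apply: IHP.
- by case=> gP gQ; split; [apply: IHP | apply: IHQ].
- case=> n0P gP; split; last exact: IHP.
  by apply: contra n0P => /exposed_pren[[|m]].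
Qed.

Lemma exposed_psubst t n P :
  exposed n (psubst t P) -> exists2 m, exposed m P & exposed n (t m).
Proof.
elim: P t n => //= [e P IHP Q IHQ|P IHP|m] t n.
- by case/orP=> [/IHP|/IHQ] [m mP nm]; exists m; rewrite ?mP ?orbT.
- case/IHP=> -[|m] mP //= /exposed_pren[k kt [<-]]; by exists m.
- by exists m.
Qed.

Lemma guarded_psubst t P :
  (forall n, guarded (t n)) -> guarded P -> guarded (psubst t P).
Proof.
elim: P t => //= [p I P IHP|e P IHP Q IHQ|P IHP] t gt.
- by move=> gP i; apply: IHP => // n; apply: guarded_pren.
- by case=> gP gQ; split; [apply: IHP | apply: IHQ].
- case=> n0P gP; split; last by apply: IHP => // -[|n] //=; apply: guarded_pren.
  (* Under the binder the images of [t] have their process variables shifted by one, so an exposed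
     variable 0 can only come from variable 0 of [P]. *)
  by apply: contra n0P => /exposed_psubst[[|m]] //= _ /exposed_pren[].
Qed.

Lemma guarded_unfold P : guarded (pmu P) -> guarded (psubst1 (pmu P) P).
Proof. by move=> gP; apply: guarded_psubst; [case|case: gP]. Qed.

(** * Subsorting and subtyping *)

Lemma subsort_trans S2 S1 S3 : subsort S1 S2 -> subsort S2 S3 -> subsort S1 S3.
Proof. by case=> // H; inv H; constructor. Qed.

Lemma subtype_refl T : subtype T T.
Proof.
move: T; cofix CIH => -[|p I S T|p I S T]; constructor; rewrite ?fsubset_refl //.
- by move=> i j /val_inj <-; constructor.
- by move=> i j /val_inj <-; apply: CIH.
- by move=> i j /val_inj <-; constructor.
- by move=> i j /val_inj <-; apply: CIH.
Qed.

Lemma subtype_recv_inv p (I J : labelset) S T S' T' :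
  subtype (@lrecv p I S T) (@lrecv p J S' T') ->
  [/\ J `<=` I,
      forall (i : I) (j : J), fsval i = fsval j -> subsort (S' j) (S i)
    & forall (i : I) (j : J), fsval i = fsval j -> subtype (T i) (T' j)].
Proof. by move=> H; inv H. Qed.

Lemma subtype_send_inv p (I J : labelset) S T S' T' :
  subtype (@lsend p I S T) (@lsend p J S' T') ->
  [/\ I `<=` J,
      forall (i : I) (j : J), fsval i = fsval j -> subsort (S i) (S' j)
    & forall (i : I) (j : J), fsval i = fsval j -> subtype (T i) (T' j)].
Proof. by move=> H; inv H. Qed.

Lemma subtype_recv_shape p (I : labelset) S T U :
  subtype (@lrecv p I S T) U -> exists J S' T', U = @lrecv p J S' T'.
Proof. by move=> H; inv H; do 3 eexists. Qed.

Lemma subtype_send_shape p (I : labelset) S T U :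
  subtype (@lsend p I S T) U -> exists J S' T', U = @lsend p J S' T'.
Proof. by move=> H; inv H; do 3 eexists. Qed.

Lemma subtype_endr T : subtype T lend -> T = lend.
Proof. by move=> H; inv H. Qed.

Lemma fsubset_lift (I J : labelset) (i : I) :
  I `<=` J -> exists j : J, fsval i = fsval j.
Proof. by move/fsubsetP/(_ _ (valP i)) => iJ; exists [` iJ]. Qed.

(** Outer indices with a common label are compared through the middle index carrying that label,
    which the inclusion of label sets provides. *)
Lemma subtype_trans T1 T2 T3 : subtype T1 T2 -> subtype T2 T3 -> subtype T1 T3.
Proof.
move: T1 T2 T3; cofix CIH => T1 T2 T3 []; first by [].
- move=> p I J S T S' T' JI SS TT H.
  case: (subtype_recv_shape H) => [K [S3 [T3' ?]]]; subst T3.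
  case: (subtype_recv_inv H) => [KJ SS' TT'].
  constructor; first exact: fsubset_trans KJ JI.
  + move=> i k ik; case: (fsubset_lift k KJ) => [j kj].
    by apply: subsort_trans (SS' j k _) (SS i j _); rewrite ?ik.
  + move=> i k ik; case: (fsubset_lift k KJ) => [j kj].
    by apply: CIH (TT i j _) (TT' j k _); rewrite ?ik.
- move=> p I J S T S' T' IJ SS TT H.
  case: (subtype_send_shape H) => [K [S3 [T3' ?]]]; subst T3.
  case: (subtype_send_inv H) => [JK SS' TT'].
  constructor; first exact: fsubset_trans IJ JK.
  + move=> i k ik; case: (fsubset_lift i IJ) => [j ij].
    by apply: subsort_trans (SS i j _) (SS' j k _); rewrite -?ij.
  + move=> i k ik; case: (fsubset_lift i IJ) => [j ij].
    by apply: CIH (TT i j _) (TT' j k _); rewrite -?ij.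
Qed.

(** * Typing of expressions and processes *)

Lemma typ_expr_subst The The' s e S :
  typ_expr The e S ->
  (forall n S', onth The n = Some S' -> typ_expr The' (s n) S') ->
  typ_expr The' (esubst s e) S.
Proof.
move=> tye sP; elim: tye => /=; try by econstructor; eauto.
by move=> n S'; apply: sP.
Qed.

Lemma typ_expr_ren The The' r e S :
  typ_expr The e S ->
  (forall n S', onth The n = Some S' -> onth The' (r n) = Some S') ->
  typ_expr The' (eren r e) S.
Proof. by move=> tye rP; apply: typ_expr_subst tye _ => n S' /rP; constructor. Qed.

(** Values are closed, hence the arbitrary target context. The evaluation rule of each operator
    already fixes the sort of its result, so only choice and subsumption need the induction
    hypothesis. *)
Lemma typ_evals The The' e S v :
  typ_expr The e S -> evals e v -> typ_expr The' (eval v) S.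
Proof.
move=> tye; elim: tye v => {e S}.
- by move=> n S _ v H; inversion H.
- by move=> v S tyv v' H; inversion H; subst; constructor.
- by move=> e _ _ v H; inversion H; do 2 constructor.
- by move=> e _ _ v H; inversion H; do 2 constructor.
- by move=> e _ _ v H; inversion H; do 2 constructor.
- by move=> e1 e2 S _ IH1 _ IH2 v H; inversion H; subst; [apply: IH1|apply: IH2].
- by move=> e S S' _ IH SS' v ev; apply: typ_esub SS'; apply: IH.
Qed.

Lemma typ_proc_pesubst The The' Thp s P T :
  typ_proc The Thp P T ->
  (forall n S, onth The n = Some S -> typ_expr The' (s n) S) ->
  typ_proc The' Thp (pesubst s P) T.
Proof.
move=> tyP; elim: tyP The' s => {The Thp P T} /=; try by econstructor; eauto.
- move=> The Thp e P1 P2 T tye _ IH1 _ IH2 The' s sP.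
  by apply: typ_pif; [apply: typ_expr_subst tye sP | apply: IH1 | apply: IH2].
- move=> The Thp p I P S T _ IH The' s sP; apply: typ_precv => i.
  apply: IH => -[|n] S' /=; first by case=> <-; constructor.
  by move/sP => tys; apply: typ_expr_ren tys _.
- move=> The Thp p l e P S T tye _ IH The' s sP.
  by apply: typ_psend; [apply: typ_expr_subst tye sP | apply: IH].
Qed.

(** Serves as weakening in both contexts when a process substitution passes under an input or a
    recursion. *)
Lemma typ_proc_pren The The' Thp Thp' r x P T :
  typ_proc The Thp P T ->
  (forall n S, onth The n = Some S -> onth The' (r n) = Some S) ->
  (forall n U, onth Thp n = Some U -> onth Thp' (x n) = Some U) ->
  typ_proc The' Thp' (pren r x P) T.
Proof.
move=> tyP; elim: tyP The' Thp' r x => {The Thp P T} /=.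
- by constructor.
- by move=> The Thp n T nT The' Thp' r x _ xP; constructor; apply: xP.
- move=> The Thp P T _ IH The' Thp' r x rP xP; constructor.
  by apply: IH => // -[|n] U //=; apply: xP.
- move=> The Thp e P1 P2 T tye _ IH1 _ IH2 The' Thp' r x rP xP.
  by constructor; [apply: typ_expr_ren tye rP | apply: IH1 | apply: IH2].
- by move=> The Thp P T T' _ IH TT' The' Thp' r x rP xP; apply: typ_psub TT'; apply: IH.
- move=> The Thp p I P S T _ IH The' Thp' r x rP xP; constructor => i.
  by apply: IH => // -[|n] U //=; apply: rP.
- move=> The Thp p l e P S T tye _ IH The' Thp' r x rP xP.
  by constructor; [apply: typ_expr_ren tye rP | apply: IH].
Qed.

Lemma typ_proc_psubst The Thp Thp' t P T :
  typ_proc The Thp P T ->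
  (forall n U, onth Thp n = Some U -> typ_proc The Thp' (t n) U) ->
  typ_proc The Thp' (psubst t P) T.
Proof.
move=> tyP; elim: tyP Thp' t => {The Thp P T} /=.
- by constructor.
- by move=> The Thp n T nT Thp' t; apply.
- move=> The Thp P T _ IH Thp' t tP; constructor.
  apply: IH => -[|n] U /=; first by case=> <-; constructor.
  by move/tP => tyt; apply: typ_proc_pren tyt _ _.
- move=> The Thp e P1 P2 T tye _ IH1 _ IH2 Thp' t tP.
  by constructor; [ | apply: IH1 | apply: IH2].
- by move=> The Thp P T T' _ IH TT' Thp' t tP; apply: typ_psub TT'; apply: IH.
- move=> The Thp p I P S T _ IH Thp' t tP; constructor => i.
  by apply: IH => n U /tP tyt; apply: typ_proc_pren tyt _ _.
- by move=> The Thp p l e P S T tye _ IH Thp' t tP; constructor => //; apply: IH.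
Qed.

Lemma typ_vsubst1 The Thp S T v P :
  typ_expr The (eval v) S -> typ_proc (S :: The) Thp P T ->
  typ_proc The Thp (vsubst1 v P) T.
Proof.
move=> tyv tyP; apply: typ_proc_pesubst tyP _ => -[|n] S' /=; last by constructor.
by case=> <-.
Qed.

(** A derivation may end in any number of subsumptions, so this inversion and those for input and
    output recover the syntax-directed premises only up to a smaller type. *)
Lemma typ_pmu_inv The Thp P T :
  typ_proc The Thp (pmu P) T ->
  exists2 U, typ_proc The (U :: Thp) P U & subtype U T.
Proof.
move E : (pmu P) => Q tyQ; elim: tyQ P E => {The Thp Q T} //.
- by move=> The Thp P T tyP _ _ [->]; exists T => //; apply: subtype_refl.
- move=> The Thp Q T T' _ IH TT' P /IH[U tyP UT].
  by exists U => //; apply: subtype_trans TT'.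
Qed.

Lemma typ_pif_inv The Thp e P Q T :
  typ_proc The Thp (pif e P Q) T ->
  typ_proc The Thp P T /\ typ_proc The Thp Q T.
Proof.
move E : (pif e P Q) => R tyR; elim: tyR P Q E => {The Thp R T} //.
- by move=> The Thp e' P1 P2 T _ ty1 _ ty2 _ P Q [_ -> ->].
- by move=> The Thp R T T' _ IH TT' P Q /IH[tyP tyQ]; split; apply: typ_psub TT'.
Qed.

Lemma typ_precv_inv The Thp p (I : labelset) (P : I -> proc) T :
  typ_proc The Thp (precv p P) T ->
  exists S U, (forall i : I, typ_proc (S i :: The) Thp (P i) (U i)) /\
              subtype (@lrecv p I S U) T.
Proof.
move E : (precv p P) => Q tyQ; elim: tyQ P E => {The Thp Q T} //.
- move=> The Thp Q T T' _ IH TT' P /IH[S [U [tyP UT]]].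
  by exists S, U; split=> //; apply: subtype_trans TT'.
- move=> The Thp p' J P' S T tyP _ P E; inv E.
  by exists S, T; split=> //; apply: subtype_refl.
Qed.

Lemma typ_psend_inv The Thp p l e P T :
  typ_proc The Thp (psend p l e P) T ->
  exists S U, [/\ typ_expr The e S, typ_proc The Thp P U
    & subtype (@lsend p (labelset1 l) (fun=> S) (fun=> U)) T].
Proof.
move E : (psend p l e P) => Q tyQ; elim: tyQ P E => {The Thp Q T} //.
- move=> The Thp Q T T' _ IH TT' P /IH[S [U [tye tyP UT]]].
  by exists S, U; split=> //; apply: subtype_trans TT'.
- move=> The Thp p' l' e' P' S T tye tyP _ P [-> -> -> ->].
  by exists S, T; split=> //; apply: subtype_refl.
Qed.

Lemma typ_unfold The Thp P T :
  typ_proc The Thp (pmu P) T -> typ_proc The Thp (psubst1 (pmu P) P) T.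
Proof.
(* The substitution is done at [U], the type assumed for variable 0 in the body; passing to [T]
   first would break this match. *)
case/typ_pmu_inv=> U tyP UT; apply: typ_psub UT.
apply: (typ_proc_psubst tyP) => -[|n] V /=; last by constructor.
by case=> <-; constructor.
Qed.

(** * Sessions *)

Lemma forall_components_impl (F F' : participant -> proc -> Prop) M :
  (forall p P, p \in participants M -> F p P -> F' p P) ->
  forall_components F M -> forall_components F' M.
Proof.
elim: M => //= [p P|M IHM N IHN] FF'.
- by apply: FF'; rewrite inE.
- by case=> /IHM FM /IHN FN; split; [apply: FM|apply: FN] => r R rM;
    apply: FF'; rewrite mem_cat rM ?orbT.
Qed.

Lemma scong_participants M N :
  scong M N -> perm_eq (participants M) (participants N).
Proof.
elim=> {M N} //=.
- by move=> M N _; rewrite perm_sym.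
- by move=> L M N _ LM _; apply: perm_trans.
- by move=> M M' N N' _ MM' _ NN'; apply: perm_cat.
- by move=> M N; rewrite perm_catC.
- by move=> L M N; rewrite catA.
- by move=> M; rewrite cats0.
Qed.

Lemma scong_components F M N :
  scong M N -> forall_components F M <-> forall_components F N.
Proof. by elim=> {M N} //=; tauto. Qed.

Lemma sunfold_participants M N :
  sunfold M N -> perm_eq (participants M) (participants N).
Proof.
elim=> {M N} //=; first exact: scong_participants.
by move=> L M N _ LM _; apply: perm_trans.
Qed.

(** The predicate is abstract because guardedness and typing are both transported this way. A
    conditional must give [F] on both branches, so the outcome of the test is irrelevant. *)
Lemma sunfold_components (F : participant -> proc -> Prop) M N :
  (forall p P, F p (pmu P) -> F p (psubst1 (pmu P) P)) ->
  (forall p e P Q, F p (pif e P Q) -> F p P /\ F p Q) ->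
  sunfold M N -> forall_components F M -> forall_components F N.
Proof.
move=> Fmu Fif; elim=> {M N} //=.
- by move=> M N /(scong_components F)[].
- by move=> L M N _ LM _ MN /LM/MN.
- by move=> p P N [/Fmu].
- by move=> p e P Q N _ [/Fif[]].
- by move=> p e P Q N _ [/Fif[]].
Qed.

Lemma typ_session_sunfold Gam M N :
  sunfold M N -> typ_session Gam M -> typ_session Gam N.
Proof.
move=> MN [[uM gM] tyM exG]; split=> //.
- split; first by rewrite -(perm_uniq (sunfold_participants MN)).
  by apply: sunfold_components MN gM => [_ P|_ e P Q //]; apply: guarded_unfold.
- apply: sunfold_components MN tyM => [p P|p e P Q] [T pT tyP].
    by exists T => //; apply: typ_unfold.
  by case: (typ_pif_inv tyP) => tyP1 tyQ; split; exists T.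
Qed.

(** * Global types *)

Lemma gpart_inv p q r (I : labelset) S G :
  gpart r (@gmsg p q I S G) -> [\/ r = p, r = q | exists i, gpart r (G i)].
Proof.
by move=> rG; inv rG; [constructor 1|constructor 2|constructor 3; exists i].
Qed.

Lemma gpart_root p q r (I : labelset) S G :
  r = p \/ r = q -> gpart r (@gmsg p q I S G).
Proof. by case=> ->; [apply: gpart_sender|apply: gpart_receiver]. Qed.

Lemma proj_msg_inv p q r (I : labelset) S G T :
  proj (@gmsg p q I S G) r T ->
  [\/ T = lend /\ ~ gpart r (@gmsg p q I S G),
      r = q /\ exists2 U, T = @lrecv p I S U & forall i, proj (G i) r (U i),
      r = p /\ exists2 U, T = @lsend q I S U & forall i, proj (G i) r (U i)
    | [/\ r != p, r != q & forall i, proj (G i) r T]].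
Proof.
move=> prT; inv prT.
- by constructor 1.
- by constructor 2; split=> //; exists T0.
- by constructor 3; split=> //; exists T0.
- by constructor 4.
Qed.

Lemma proj_not_gpart G r T : proj G r T -> ~ gpart r G -> T = lend.
Proof. by case=> // p q I S H U _ []; constructor. Qed.

(** By induction on an occurrence of [r]: a node involving [r] projects to an input or output, and
    any other node hands [lend] down to its branches. *)
Lemma proj_end_not_gpart G r : proj G r lend -> ~ gpart r G.
Proof.
move=> prG rG; elim: rG prG => {G} [q I S G|p I S G|p q I S G i rG IH].
- case/proj_msg_inv=> [[_]|[_ [U //]]|[_ [U //]]|[/eqP //]].
  by case; apply: gpart_sender.
- case/proj_msg_inv=> [[_]|[_ [U //]]|[_ [U //]]|[_ /eqP //]].
  by case; apply: gpart_receiver.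
- case/proj_msg_inv=> [[_]|[_ [U //]]|[_ [U //]]|[_ _ /(_ i)/IH //]].
  by case; apply: gpart_cont rG.
Qed.

Lemma proj_gpart G r T : proj G r T -> T <> lend -> gpart r G.
Proof. by case=> // p q I S H U *; constructor. Qed.

Lemma ltype_end_dec T : T = lend \/ T <> lend.
Proof. by case: T; [left|right|right]. Qed.

(** Participation in an infinite tree cannot be decided by searching it; the head constructor of the
    projection decides it. *)
Lemma gpart_dec G r : projectable G -> gpart r G \/ ~ gpart r G.
Proof.
move=> /(_ r)[T prT]; have [T0|T0] := ltype_end_dec T.
  by right; apply: proj_end_not_gpart; rewrite -T0.
by left; apply: proj_gpart prT T0.
Qed.

(* The premise of proj_other that r is a participant is automatic unless T is
   end, where proj_end applies. *)
Lemma proj_skip p q r (I : labelset) S G T :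
  r != p -> r != q -> (forall i : I, proj (G i) r T) ->
  proj (@gmsg p q I S G) r T.
Proof.
move=> rp rq prG; have [i0 _] := labelset_inhabited I.
have [T0|T0] := ltype_end_dec T; last first.
  apply: proj_other => //; apply: (@gpart_cont _ _ _ _ _ _ i0).
  exact: proj_gpart (prG i0) T0.
subst T; apply: proj_end => /gpart_inv[/eqP|/eqP|[i rG]].
- by rewrite (negPf rp).
- by rewrite (negPf rq).
- exact: proj_end_not_gpart (prG i) rG.
Qed.

Lemma projectable_cont p q (I : labelset) S G (i : I) :
  projectable (@gmsg p q I S G) -> projectable (G i).
Proof.
move=> prG r; have [T] := prG r.
case/proj_msg_inv=> [[_ rG]|[_ [U _ prU]]|[_ [U _ prU]]|[_ _ prT]].
- by exists lend; apply: proj_end => rGi; apply: rG; apply: gpart_cont rGi.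
- by exists (U i).
- by exists (U i).
- by exists T.
Qed.

Lemma projectable_gpath G w G' : gpath G w G' -> projectable G -> projectable G'.
Proof. by elim=> // p q I S G0 i w' G1 _ IH prG; apply: IH; apply: projectable_cont prG. Qed.

Lemma gpath_msg_inv p q (I : labelset) S G w G' :
  gpath (@gmsg p q I S G) w G' ->
  w = [::] /\ G' = @gmsg p q I S G \/
  exists i w', w = (p, q) :: w' /\ gpath (G i) w' G'.
Proof. by move=> pw; inv pw; [left|right; exists i, w0]. Qed.

Lemma gpath_cat G w G' w' G'' :
  gpath G w G' -> gpath G' w' G'' -> gpath G (w ++ w') G''.
Proof. by elim=> //= p q I S G0 i w0 G1 _ IH /IH; apply: gpath_cons. Qed.

Lemma balanced_gpath G w G' : gpath G w G' -> balanced G -> balanced G'.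
Proof. by move=> GG' bG w' G'' G'G''; apply: bG (gpath_cat GG' G'G''). Qed.

(** * Contraction of a communication in a global type *)

(* The communication may occur below the root, as long as the nodes above it
   involve neither p nor q; it is then performed in every branch. *)
Inductive gstep (p q : participant) (l : label) : gtype -> gtype -> Prop :=
| gstep_root (I : labelset) S G (i : I) :
    fsval i = l -> gstep p q l (@gmsg p q I S G) (G i)
| gstep_skip r s (I : labelset) S G G' :
    p != r -> p != s -> q != r -> q != s ->
    (forall i : I, gstep p q l (G i) (G' i)) ->
    gstep p q l (@gmsg r s I S G) (@gmsg r s I S G').

(* By balancedness, a node involving p is reached on every branch within k
   steps; its shape and the absence of q above it follow from projection. *)
Lemma gstep_exists p q l G (K : labelset) S T (J : labelset) S' T' (k : K) :
  balanced G -> fsval k = l ->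
  proj G p (@lsend q K S T) -> proj G q (@lrecv p J S' T') ->
  exists G', gstep p q l G G'.
Proof.
move=> bG kl prp prq; have [b bP] := bG _ _ (gpath_nil G).
have {bP}: forall w G'', gpath G w G'' -> b <= size w \/ G'' = gend ->
    occurs p w by apply: bP; apply: proj_gpart prp _.
elim: b G prp prq {bG} => [|b IH] G prp prq bP.
  by have := bP _ _ (gpath_nil G) (or_introl (leq0n _)).
case: G prp prq bP => [H|p0 q0 I S0 G0]; first by inversion H.
case/proj_msg_inv=> [[]|[_ [] //]|[-> [U E _]]|[pp0 pq0 prp]] //.
  by inv E => _ _; exists (G0 k); constructor.
(* If [q] received at the root, its input from [p] would make [p] the sender there, against
   [pp0]. *)
case/proj_msg_inv=> [[]|[_ [U [E] _]]|[_ [] //]|[qp0 qq0 prq]] bP //.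
  by rewrite E eqxx in pp0.
(* Finitely many branches, so their reducts form a family without a choice axiom. The bound drops by
   one since the root does not involve [p]. *)
have [i|G' G'P] := fin_all_exists (P := fun i U => gstep p q l (G0 i) U).
  apply: IH => // w G'' pw wb.
  have := bP _ _ (@gpath_cons p0 q0 I S0 G0 i _ _ pw).
  rewrite /occurs /= (negPf pp0) (negPf pq0); apply.
  by case: wb; [left|right].
by exists (@gmsg p0 q0 I S0 G'); constructor.
Qed.

Lemma gstep_gpart p q l G G' r : gstep p q l G G' -> gpart r G' -> gpart r G.
Proof.
elim=> {G G'} [I S G i _ rG|p0 q0 I S G G' _ _ _ _ _ IH]; first exact: gpart_cont rG.
case/gpart_inv=> [rp|rq|[i rG]]; [apply: gpart_root; by left| |].
  by apply: gpart_root; right.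
by apply: (@gpart_cont _ _ _ _ _ _ i); apply: IH.
Qed.

Lemma gstep_gwf p q l G G' : gstep p q l G G' -> gwf G -> gwf G'.
Proof.
elim=> {G G'} [I S G i _|p0 q0 I S G G' _ _ _ _ _ IH] wG; inv wG => //.
by constructor=> // i; apply: IH.
Qed.

(** At a contracted message [r] is a bystander, so its projection is the same in all branches, in
    particular in the one kept. *)
Lemma gstep_proj p q l G G' r T :
  gstep p q l G G' -> r != p -> r != q -> proj G r T -> proj G' r T.
Proof.
move=> st rp rq; elim: (st) T => {G G' st} [I S G i _|p0 q0 I S G G' pp0 pq0 qp0 qq0 st IH] T.
  case/proj_msg_inv=> [[-> rG]|[/eqP]|[/eqP]|[_ _ /(_ i) //]].
  - by apply: proj_end => rGi; apply: rG; apply: gpart_cont rGi.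
  - by rewrite (negPf rq).
  - by rewrite (negPf rp).
case/proj_msg_inv=> [[-> rG]|[E [U -> prU]]|[E [U -> prU]]|[rp0 rq0 prT]].
- by apply: proj_end => rG'; apply: rG; apply: (@gstep_gpart p q l) rG'; apply: gstep_skip.
- by subst r; constructor=> i; apply: IH.
- by subst r; constructor=> i; apply: IH.
- by apply: proj_skip => // i; apply: IH.
Qed.

(** Both projections read their sorts off the same message of the global type, so the sorts at label
    [l] are equal and not merely related by subsorting. *)
Lemma gstep_proj_comm p q l G G' (K J : labelset) S T S' T' :
  gstep p q l G G' ->
  proj G p (@lsend q K S T) -> proj G q (@lrecv p J S' T') ->
  exists (k : K) (j : J), [/\ fsval k = l, fsval j = l, S k = S' j,
    proj G' p (T k) & proj G' q (T' j)].
Proof.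
elim=> {G G'} [I U G i il|p0 q0 I U G G' pp0 pq0 qp0 qq0 _ IH].
  case/proj_msg_inv=> [[]|[_ [] //]|[_ [V E prp]]|[/eqP //]] //; inv E.
  case/proj_msg_inv=> [[]|[_ [W E prq]]|[_ [] //]|[_ /eqP //]] //; inv E.
  by exists i, i.
case/proj_msg_inv=> [[//]|[_ [] //]|[/eqP]|[_ _ prp]]; first by rewrite (negPf pp0).
case/proj_msg_inv=> [[//]|[/eqP]|[_ [] //]|[_ _ prq]]; first by rewrite (negPf qq0).
have [i0 _] := labelset_inhabited I.
have [k [j [kl jl SS _ _]]] := IH i0 (prp i0) (prq i0).
(* The indices come from an arbitrary branch [i0]; the other branches yield the same ones, since an
   index is determined by its label. *)
exists k, j; split=> //; apply: proj_skip => // i;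
  have [k' [j' [kl' jl' _ pr1 pr2]]] := IH i (prp i) (prq i).
  by have -> : k = k' by apply: val_inj; rewrite /= kl kl'.
by have -> : j = j' by apply: val_inj; rewrite /= jl jl'.
Qed.

(** A subtree of the contracted tree either lies within a kept continuation, and is then a subtree
    of [G], or is itself a contraction of one. *)
Lemma gstep_gpath p q l G G' w' H' :
  gstep p q l G G' -> gpath G' w' H' ->
  exists w H, gpath G w H /\ (H = H' \/ gstep p q l H H').
Proof.
move=> st; elim: st w' => {G G'} [I S G i il|p0 q0 I S G G' ? ? ? ? st IH] w' pw.
  by exists ((p, q) :: w'), H'; split; [apply: gpath_cons pw|left].
case: (gpath_msg_inv pw) => [[_ ->]|[i [w1 [_ pw1]]]].
  by exists [::], (@gmsg p0 q0 I S G); split; [|right]; constructor.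
have [w [H [pwH HH']]] := IH _ _ pw1.
by exists ((p0, q0) :: w), H; split=> //; apply: gpath_cons pwH.
Qed.

(* Only r different from p0, q0 needs a bound from the branches; projectability
   makes such an r a participant of all of them. *)
Lemma gstep_bound p q l G G' :
  gstep p q l G G' -> balanced G -> projectable G' ->
  exists k, forall r, gpart r G' ->
    forall w G'', gpath G' w G'' -> k <= size w \/ G'' = gend -> occurs r w.
Proof.
elim=> {G G'} [I S G i il|p0 q0 I S G G' ? ? ? ? st IH] bG prG'.
  by apply: (bG [:: (p, q)]); apply: gpath_cons (gpath_nil _).
have [i|b bP] := fin_all_exists (P := fun i b => forall r, gpart r (G' i) ->
    forall w G'', gpath (G' i) w G'' -> b <= size w \/ G'' = gend -> occurs r w).
  apply: IH; last exact: projectable_cont prG'.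
  by apply: balanced_gpath bG; apply: gpath_cons (gpath_nil _).
(* The extra one accounts for the root, and rules out the empty path, which is too short and does
   not end in [gend]. *)
exists (\max_i b i).+1 => r rG' w G'' /gpath_msg_inv[[-> -> []] //|[i [w' [-> pw]]]] wb.
 rewrite /occurs /=; case: eqVneq => //= rp0; case: eqVneq => //= rq0.
apply: (bP i _ _ _ _ pw); last first.
  by case: wb; [move=> /ltnSE wb; left; apply: leq_trans wb; apply: leq_bigmax|right].
have [T /proj_msg_inv] := prG' r.
case=> [[_ //]|[/eqP]|[/eqP]|[_ _ prT]]; rewrite ?(negPf rp0) ?(negPf rq0) //.
apply: proj_gpart (prT i) _ => T0; subst T.
by apply: proj_end_not_gpart rG'; apply: proj_skip.
Qed.

Lemma gstep_balanced p q l G G' :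
  gstep p q l G G' -> balanced G -> projectable G' -> balanced G'.
Proof.
move=> st bG prG' w' H' pw'; have [w [H [pw [HH'|HH']]]] := gstep_gpath st pw'.
  by apply: bG; rewrite -HH'; exact: pw.
exact: gstep_bound HH' (balanced_gpath pw bG) (projectable_gpath pw' prG').
Qed.

(** * Environments *)

(** The frame rule adds one participant at a time, hence an induction on the size of the domain of
    [C] that removes some [r] and puts it back by an update. *)
Lemma env_step_frame_cat (A B C : env) a :
  [disjoint domf A & domf C] -> [disjoint domf B & domf C] ->
  env_step A a B -> env_step (A + C) a (B + C).
Proof.
move=> AC BC st; move En : #|` domf C| => n.
elim: n C AC BC En => [|n IH] C AC BC En.
  have C0 x : x \in domf C = false by rewrite (cardfs0_eq En) inE.
  have catC (D : env) : D + C = D by apply/fmapP => x; rewrite fnd_cat C0.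
  by rewrite !catC.
have /fset0Pn[r rC] : domf C != fset0 by rewrite -cardfs_gt0 En.
pose C' := C.[~ r].
have catC (D : env) : D + C = (D + C').[r <- C.[rC]].
  apply/fmapP => x; rewrite fnd_set !fnd_cat; case: eqVneq => [->|xr].
    by rewrite rC in_fnd.
  by rewrite /C' mem_remf1 xr fnd_rem1 xr.
have sC : domf C' `<=` domf C.
  by apply/fsubsetP => x; rewrite mem_remf1 => /andP[].
have disC (D : env) : [disjoint domf D & domf C] ->
    [disjoint domf D & domf C'] /\ r \notin domf (D + C').
  move=> DC; split; first exact: fdisjointWr sC DC.
  rewrite mem_catf mem_remf1 eqxx orbF.
  by move: DC; rewrite fdisjoint_sym => /fdisjointP; apply.
have [AC' rA] := disC _ AC; have [BC' rB] := disC _ BC.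
rewrite !catC; apply: env_step_frame => //; apply: IH => //.
move: En; rewrite (cardfsD1 r (domf C)) rC => -[<-].
by congr #|` _|; apply/fsetP => x; rewrite mem_remf1 !inE.
Qed.

Lemma mem_env1 (p x : participant) (T : ltype) :
  (x \in domf ([fmap].[p <- T] : env)) = (x == p).
Proof. by rewrite mem_setf !inE. Qed.

(** The environment splits into the singletons at [p] and [q], on which the communication rule acts,
    and a remainder [C] that is framed. The target splits in the same way. *)
Lemma env_step_comm_at (Gam : env) p q (K J : labelset) S T S' T'
    (k : K) (j : J) :
  p != q -> Gam.[? p] = Some (@lsend q K S T) ->
  Gam.[? q] = Some (@lrecv p J S' T') -> fsval k = fsval j ->
  subsort (S k) (S' j) ->
  env_step Gam (acomm p q (fsval k)) Gam.[p <- T k].[q <- T' j].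
Proof.
move=> pq Gp Gq kj SS; pose C := Gam.[\ [fset p; q]].
have disj (U V : ltype) :
    [disjoint domf ([fmap].[p <- U] : env) & domf ([fmap].[q <- V] : env)].
  by apply/fdisjointP => x; rewrite !mem_env1 => /eqP->.
have disjC (U V : ltype) :
    [disjoint domf (([fmap].[p <- U] : env) + [fmap].[q <- V]) & domf C].
  apply/fdisjointP => x; rewrite mem_catf !mem_env1.
  by rewrite mem_remf !inE => ->.
have catC (U V : ltype) (D : env) :
    D.[? p] = Some U -> D.[? q] = Some V ->
    (forall x, x != p -> x != q -> D.[? x] = Gam.[? x]) ->
    D = ([fmap].[p <- U] : env) + [fmap].[q <- V] + C.
  move=> Dp Dq Dx; apply/fmapP => x.
  rewrite !fnd_cat mem_env1 mem_remf !inE !fnd_set fnd_rem !inE.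
  case: (eqVneq x p) => [->|xp] /=; first by rewrite (negPf pq).
  case: (eqVneq x q) => [->|xq] /=; first by [].
  by rewrite Dx //; case: fndP => // xG; rewrite not_fnd.
rewrite [X in env_step X _ _](catC _ _ Gam Gp Gq) //.
rewrite [X in env_step _ _ X](catC (T k) (T' j)); first last.
- by move=> x xp xq; rewrite !fnd_set (negPf xp) (negPf xq).
- by rewrite fnd_set eqxx.
- by rewrite !fnd_set (negPf pq) eqxx.
apply: env_step_frame_cat => //.
by apply: env_step_comm SS => //; [constructor | rewrite kj; constructor].
Qed.

(** * Subject reduction *)

Lemma assoc_some Gam G r T :
  projectable G -> assoc Gam G -> Gam.[? r] = Some T -> T <> lend ->
  exists2 U, proj G r U & subtype T U.
Proof.
move=> prG [as1 as2] rT T0; have [/as1|/as2] := gpart_dec r prG.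
  by case=> T1 [U [rT1 prU TU]]; exists U => //; move: rT1; rewrite rT => -[->].
by rewrite rT => -[|[]].
Qed.

Lemma subject_reduction_comm Gam p q (I : labelset) (P : I -> proc) (i : I)
    e v Q N :
  evals e v ->
  typ_session Gam (spar (spar (sproc q (precv p P))
                      (sproc p (psend q (fsval i) e Q))) N) ->
  exists Gam' : env, env_step Gam (acomm p q (fsval i)) Gam' /\
    typ_session Gam' (spar (spar (sproc q (vsubst1 v (P i))) (sproc p Q)) N).
Proof.
move=> ev [[uM [[gP gQ] gN]] [[[Tq Gq tyP] [Tp Gp tyQ]] tyN]].
case=> G [bG wG prG asG].
move: uM => /=; rewrite inE negb_or => /and3P[/andP[]].
rewrite eq_sym => pq qN pN uN.
have [Se [Ue [tye tyQ' subp]]] := typ_psend_inv tyQ.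
have [Si [Ui [tyP' subq]]] := typ_precv_inv tyP.
have [K [Sk [Tk ETp]]] := subtype_send_shape subp.
have [J [Sj [Tj ETq]]] := subtype_recv_shape subq.
subst Tp Tq.
have [|VP prp subp'] := assoc_some prG asG Gp; first by [].
have [|VQ prq subq'] := assoc_some prG asG Gq; first by [].
have [K' [Sk' [Tk' EVP]]] := subtype_send_shape subp'.
have [J' [Sj' [Tj' EVQ]]] := subtype_recv_shape subq'.
subst VP VQ.
(* Label inclusions run from process to projection for the sender and from projection to process for
   the receiver. So the label sent climbs to the projection on [p], crosses to [q] through the
   contracted messages, and descends to the input process. *)
have [IK SeSk UeTk] := subtype_send_inv subp.
have [KK' SkSk' TkTk'] := subtype_send_inv subp'.
have [JI SjSi UiTj] := subtype_recv_inv subq.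
have [J'J SjSj' TjTj'] := subtype_recv_inv subq'.
have i1 : fsval i \in labels (labelset1 (fsval i)) by rewrite /= inE.
have [k ik] := fsubset_lift [` i1] IK; rewrite /= in ik.
have [k' kk'] := fsubset_lift k KK'.
have [G' st] := gstep_exists bG (esym (etrans ik kk')) prp prq.
have [k2 [j' [k2i j'i SS prp' prq']]] := gstep_proj_comm st prp prq.
have ? : k2 = k' by apply: val_inj; rewrite /= k2i ik.
subst k2.
have [j j'j] := fsubset_lift j' J'J.
have kj : fsval k = fsval j by rewrite -ik -j'j.
have SkSj : subsort (Sk k) (Sj j).
  by apply: subsort_trans (SkSk' _ _ kk') _; rewrite SS; apply: SjSj'.
pose Gam' := Gam.[p <- Tk k].[q <- Tj j].
have Gp' : Gam'.[? p] = Some (Tk k) by rewrite !fnd_set (negPf pq) eqxx.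
have Gq' : Gam'.[? q] = Some (Tj j) by rewrite fnd_set eqxx.
have Gr' r : r != p -> r != q -> Gam'.[? r] = Gam.[? r].
  by move=> rp rq; rewrite !fnd_set (negPf rp) (negPf rq).
have prG' : projectable G'.
  move=> r; have [->|rp] := eqVneq r p; first by exists (Tk' k').
  have [->|rq] := eqVneq r q; first by exists (Tj' j').
  by have [T prT] := prG r; exists T; apply: gstep_proj st _ _ prT.
exists Gam'; split; first by rewrite ik; apply: env_step_comm_at Gp Gq kj SkSj.
split.
- split; first by rewrite /= inE negb_or eq_sym pq qN pN.
  by split=> //; split=> //; apply: guarded_pesubst.
- split; [split|].
  (* The value received is typed along the chain [Se], [Sk k], [Sj j], [Si i] of increasing
     sorts. *)
  + exists (Tj j) => //; apply: (typ_psub _ (UiTj i j _)); last by rewrite -j'j j'i.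
    apply: typ_vsubst1 (tyP' i); apply: typ_esub (SjSi i j _); last by rewrite -j'j j'i.
    apply: typ_esub SkSj; apply: typ_esub (SeSk [` i1] k ik).
    exact: typ_evals tye ev.
  + by exists (Tk k) => //; apply: typ_psub tyQ' (UeTk [` i1] k ik).
  + apply: forall_components_impl tyN => r R rN [T rT tyR]; exists T => //.
    by rewrite Gr' //; [apply: contraNneq pN|apply: contraNneq qN] => <-.
- exists G'; split=> //.
  + exact: gstep_balanced st bG prG'.
  + exact: gstep_gwf st wG.
  + have [as1 as2] := asG; split=> r.
      have [->|rp] := eqVneq r p.
        by exists (Tk k), (Tk' k'); split=> //; apply: TkTk'.
      have [->|rq] := eqVneq r q.
        by exists (Tj j), (Tj' j'); split=> //; apply: TjTj'.
      move=> /(gstep_gpart st)/as1[T [T' [rT prT TT']]].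
      by exists T, T'; split=> //; [rewrite Gr'|apply: gstep_proj st _ _ prT].
    (* A participant that has just finished keeps an entry in the environment: its projection is
       [lend], and only [lend] is a subtype of that. *)
    have [->|rp] := eqVneq r p.
      move=> /(proj_not_gpart prp') E; right; rewrite Gp'; congr Some.
      by apply: subtype_endr; rewrite -E; apply: TkTk'.
    have [->|rq] := eqVneq r q.
      move=> /(proj_not_gpart prq') E; right; rewrite Gq'; congr Some.
      by apply: subtype_endr; rewrite -E; apply: TjTj'.
    move=> rG'; rewrite Gr' //; apply: as2; have [T prT] := prG r.
    (* Contraction discards branches but preserves the projection on [r]; this being [lend], [r] was
       absent from [G] already. *)
    have E := proj_not_gpart (gstep_proj st rp rq prT) rG'.
    by apply: proj_end_not_gpart; rewrite -E.
Qed.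

Theorem mainTheorem5 (Gam : env) (M M' : session) (p q : participant)
    (l : label) :
  typ_session Gam M ->
  sstep M p q l M' ->
  exists Gam' : env, env_step Gam (acomm p q l) Gam' /\ typ_session Gam' M'.
Proof.
move=> tyM st; elim: st Gam tyM => {M M' p q l}.
  by move=> p q I P j e v Q N ev Gam; apply: subject_reduction_comm.
move=> M M1 N1 N p q l MM1 _ IH N1N Gam /(typ_session_sunfold MM1)/IH.
by case=> Gam' [st tyN1]; exists Gam'; split=> //; apply: typ_session_sunfold tyN1.
Qed.
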